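(* For every closed HyperLTL formula $\varphi$ and every finite Kripke structure $\mathcal{K}$ there exist a closed A-HLTL formula $\varphi'$ and a Kripke structure $\mathcal{K}'$ such that the size of $\mathcal{K}'$ is linear in the size of $\mathcal{K}$, the size of $\varphi'$ is polynomial in the size of $\varphi$, and $\mathcal{K}\models\varphi$ (HyperLTL semantics) if and only if $\mathcal{K}'\models\varphi'$ (A-HLTL semantics).
   Context: Let $\mathsf{AP}$ be a finite set of atomic propositions and $\Sigma=2^{\mathsf{AP}}$; traces are elements of $\Sigma^\omega$. A Kripke structure is $\mathcal{K}=\langle S,S_{\mathit{init}},\delta,L\rangle$ with initial states $S_{\mathit{init}}\subseteq S$, transition relation $\delta\subseteq S\times S$ where every state has a successor, and labeling $L:S\to\Sigma$; $\mathsf{Traces}(\mathcal{K})$ is the set of label sequences of paths from initial states. Temporal part: $\psi::=a_\pi\mid\neg\psi\mid\psi\vee\psi\mid\psi\,\mathcal{U}\,\psi\mid\bigcirc\psi$ ($a$ an atomic proposition, $\pi$ a trace variable). Trace assignments $\Pi$ map trace variables to pointed traces $(\sigma,p)$. HyperLTL: formulas $\varphi::=\exists\pi.\varphi\mid\forall\pi.\varphi\mid\psi$; quantifiers bind $\pi$ to $(\sigma,0)$ for some/all $\sigma\in\mathsf{Traces}(\mathcal{K})$; $\Pi\models a_\pi$ iff $a\in\sigma(p)$ for $\Pi(\pi)=(\sigma,p)$; Booleans as usual; $\Pi\models\bigcirc\psi$ iff $\Pi+1\models\psi$, where $\Pi+k$ advances every pointer by $k$; $\Pi\models\psi_1\mathcal{U}\psi_2$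 iff for some $j\ge0$, $\Pi+j\models\psi_2$ and $\Pi+i\models\psi_1$ for all $i<j$. A-HLTL: formulas $\varphi::=\exists\pi.\varphi\mid\forall\pi.\varphi\mid\mathsf{E}\psi\mid\mathsf{A}\psi$. A trajectory over $V$ is an infinite sequence $t$ of nonempty subsets of $V$, fair if each $\pi\in V$ lies in infinitely many $t(j)$. $(\Pi,t)+1=(\Pi',t(1)t(2)\cdots)$ where $\Pi'$ advances by one the pointers of the variables in $t(0)$ and keeps the others; $(\Pi,t)+k$ iterates. $\Pi\models\mathsf{E}\psi$ (resp. $\mathsf{A}\psi$) iff $(\Pi,t)\models\psi$ for some (resp. all) fair trajectories $t$ over $\mathrm{Dom}(\Pi)$; $(\Pi,t)\models a_\pi$ iff $a\in\sigma(p)$ for $\Pi(\pi)=(\sigma,p)$; Booleans as usual; $(\Pi,t)\models\bigcirc\psi$ iff $(\Pi,t)+1\models\psi$; $(\Pi,t)\models\psi_1\mathcal{U}\psi_2$ iff for some $i\ge0$, $(\Pi,t)+i\models\psi_2$ and $(\Pi,t)+j\models\psi_1$ for all $j<i$; quantifiers as in HyperLTL. In both logics $\mathcal{K}\models\varphi$ iff the empty assignment satisfies $\varphi$ with respect to $\mathsf{Traces}(\mathcal{K})$. *)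

(* Defs.v *)
From HB Require Import structures.
From mathcomp Require Import all_boot all_order all_algebra.
Set Implicit Arguments.
Unset Strict Implicit.
Unset Printing Implicit Defensive.

Definition tvar := nat.

Definition trace (AP : finType) := nat -> {set AP}.

Record kripke (AP : finType) := Kripke {
  state : finType;
  init : {set state};
  trans : rel state;
  label : state -> {set AP};
  trans_total : forall s : state, exists s' : state, trans s s'
}.

Definition kripke_size (AP : finType) (K : kripke AP) : nat :=
  #|state K| + #|[set e : state K * state K | trans e.1 e.2]|.

Definition traces (AP : finType) (K : kripke AP) (sigma : trace AP) : Prop :=
  exists rho : nat -> state K,
    [/\ rho 0 \in init K,
        forall i, trans (rho i) (rho i.+1)
      & forall i, sigma i = label (rho i)].

Inductive tform (AP : finType) : Type :=
| Atom of AP & tvar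
| Neg of tform AP
| Or of tform AP & tform AP
| Until of tform AP & tform AP
| Next of tform AP.

Inductive hyperltl (AP : finType) : Type :=
| HExists of tvar & hyperltl AP
| HForall of tvar & hyperltl AP
| HTemp of tform AP.

Inductive ahltl (AP : finType) : Type :=
| AExists of tvar & ahltl AP
| AForall of tvar & ahltl AP
| AE of tform AP
| AA of tform AP.

Fixpoint tsize (AP : finType) (psi : tform AP) : nat :=
  match psi with
  | Atom _ _ => 1
  | Neg psi1 | Next psi1 => (tsize psi1).+1
  | Or psi1 psi2 | Until psi1 psi2 => (tsize psi1 + tsize psi2).+1
  end.

Fixpoint hsize (AP : finType) (phi : hyperltl AP) : nat :=
  match phi with
  | HExists _ phi1 | HForall _ phi1 => (hsize phi1).+1
  | HTemp psi => tsize psi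
  end.

Fixpoint asize (AP : finType) (phi : ahltl AP) : nat :=
  match phi with
  | AExists _ phi1 | AForall _ phi1 => (asize phi1).+1
  | AE psi | AA psi => (tsize psi).+1
  end.

Fixpoint tvars (AP : finType) (psi : tform AP) : seq tvar :=
  match psi with
  | Atom _ x => [:: x]
  | Neg psi1 | Next psi1 => tvars psi1
  | Or psi1 psi2 | Until psi1 psi2 => tvars psi1 ++ tvars psi2
  end.

Fixpoint hfree (AP : finType) (phi : hyperltl AP) : seq tvar :=
  match phi with
  | HExists x phi1 | HForall x phi1 => [seq y <- hfree phi1 | y != x]
  | HTemp psi => tvars psi
  end.

Fixpoint afree (AP : finType) (phi : ahltl AP) : seq tvar :=
  match phi with
  | AExists x phi1 | AForall x phi1 => [seq y <- afree phi1 | y != x]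
  | AE psi | AA psi => tvars psi
  end.

Definition hclosed (AP : finType) (phi : hyperltl AP) : Prop := hfree phi = [::].
Definition aclosed (AP : finType) (phi : ahltl AP) : Prop := afree phi = [::].

Definition assignment (AP : finType) := tvar -> option (trace AP * nat).

Definition empty_assignment (AP : finType) : assignment AP := fun=> None.

Definition dom (AP : finType) (Pi : assignment AP) : pred tvar :=
  fun x => isSome (Pi x).

Definition bind (AP : finType) (Pi : assignment AP) (x : tvar)
    (sigma : trace AP) : assignment AP :=
  fun y => if y == x then Some (sigma, 0) else Pi y.

Definition advance (AP : finType) (A : pred tvar) (k : nat)
    (Pi : assignment AP) : assignment AP :=
  fun x => if A x then omap (fun sp => (sp.1, sp.2 + k)) (Pi x) else Pi x.

(* The value on an unbound variable is irrelevant for closed formulas. *)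
Definition sat_atom (AP : finType) (Pi : assignment AP) (a : AP) (x : tvar) : Prop :=
  if Pi x is Some (sigma, p) then a \in sigma p else False.

Fixpoint sat_sync (AP : finType) (Pi : assignment AP) (psi : tform AP) : Prop :=
  match psi with
  | Atom a x => sat_atom Pi a x
  | Neg psi1 => ~ sat_sync Pi psi1
  | Or psi1 psi2 => sat_sync Pi psi1 \/ sat_sync Pi psi2
  | Until psi1 psi2 =>
      exists j, sat_sync (advance xpredT j Pi) psi2 /\
        forall i, i < j -> sat_sync (advance xpredT i Pi) psi1
  | Next psi1 => sat_sync (advance xpredT 1 Pi) psi1
  end.

Fixpoint hsat (AP : finType) (T : trace AP -> Prop) (Pi : assignment AP)
    (phi : hyperltl AP) : Prop :=
  match phi with
  | HExists x phi1 => exists sigma, T sigma /\ hsat T (bind Pi x sigma) phi1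
  | HForall x phi1 => forall sigma, T sigma -> hsat T (bind Pi x sigma) phi1
  | HTemp psi => sat_sync Pi psi
  end.

Definition trajectory := nat -> pred tvar.

Definition trajectory_over (V : pred tvar) (t : trajectory) : Prop :=
  forall j, (exists x, t j x) /\ (forall x, t j x -> V x).

Definition fair (V : pred tvar) (t : trajectory) : Prop :=
  forall x, V x -> forall n, exists2 j, n <= j & t j x.

Definition async_step (AP : finType) (c : assignment AP * trajectory)
    : assignment AP * trajectory :=
  (advance (c.2 0) 1 c.1, fun j => c.2 j.+1).

Fixpoint sat_async (AP : finType) (c : assignment AP * trajectory)
    (psi : tform AP) : Prop :=
  match psi with
  | Atom a x => sat_atom c.1 a x
  | Neg psi1 => ~ sat_async c psi1
  | Or psi1 psi2 => sat_async c psi1 \/ sat_async c psi2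
  | Until psi1 psi2 =>
      exists i, sat_async (iter i (@async_step AP) c) psi2 /\
        forall j, j < i -> sat_async (iter j (@async_step AP) c) psi1
  | Next psi1 => sat_async (async_step c) psi1
  end.

Fixpoint asat (AP : finType) (T : trace AP -> Prop) (Pi : assignment AP)
    (phi : ahltl AP) : Prop :=
  match phi with
  | AExists x phi1 => exists sigma, T sigma /\ asat T (bind Pi x sigma) phi1
  | AForall x phi1 => forall sigma, T sigma -> asat T (bind Pi x sigma) phi1
  | AE psi => exists t, [/\ trajectory_over (dom Pi) t, fair (dom Pi) t
                          & sat_async (Pi, t) psi]
  | AA psi => forall t, trajectory_over (dom Pi) t -> fair (dom Pi) t ->
                sat_async (Pi, t) psi
  end.

Definition hmodels (AP : finType) (K : kripke AP) (phi : hyperltl AP) : Prop :=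
  hsat (traces K) (@empty_assignment AP) phi.

Definition amodels (AP : finType) (K : kripke AP) (phi : ahltl AP) : Prop :=
  asat (traces K) (@empty_assignment AP) phi.

(* Main.v *)
From HB Require Import structures.
From mathcomp Require Import all_boot all_order all_algebra.
From mathcomp Require Import zify.
From Stdlib Require Import Classical.
Require Import Defs.

(**
  Every state of [K] is paired with a bit that flips along each transition, so
  that a fresh proposition ([None]) records the parity of the position reached
  on each trace.  If all pointers are at the same position and a trajectory
  moves only a proper nonempty subset of them, then two pointers end up with
  different parities.  Hence requiring all quantified traces to agree on the
  parity bit forever admits exactly one trajectory, the one that always moves
  every pointer, and along it the asynchronous semantics is the synchronous one.
*)

Set Implicit Arguments.
Unset Strict Implicit.
Unset Printing Implicit Defensive.

(** * Derived connectives and agreement on a proposition *)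

Section Connectives.

Variable AP : finType.
Implicit Types (c : assignment AP * trajectory) (a : AP) (x y : tvar).

Definition t_and (f g : tform AP) : tform AP := Neg (Or (Neg f) (Neg g)).

Definition t_iff (f g : tform AP) : tform AP :=
  t_and (Or (Neg f) g) (Or (Neg g) f).

(** The excluded middle on [Atom a x] plays the role of truth on the left of [Until]; it mentions
    [x], so [x] has to be a quantified variable for the result to be closed. *)
Definition t_always (a : AP) (x : tvar) (f : tform AP) : tform AP :=
  Neg (Until (Or (Atom a x) (Neg (Atom a x))) (Neg f)).

(* The conjunction starts from a trivial equivalence because there is no
   closed formula for truth. *)
Definition t_agree (a : AP) (x : tvar) (s : seq tvar) : tform AP :=
  foldr (fun y f => t_and (t_iff (Atom a x) (Atom a y)) f)
    (t_iff (Atom a x) (Atom a x)) s.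

Lemma sat_and c f g :
  sat_async c (t_and f g) <-> sat_async c f /\ sat_async c g.
Proof.
split=> /= [h|[hf hg] [//|//]].
by split; apply: NNPP => h'; apply: h; [left|right].
Qed.

Lemma sat_iff c f g :
  sat_async c (t_iff f g) <-> (sat_async c f <-> sat_async c g).
Proof.
rewrite /t_iff sat_and /=; have := classic (sat_async c f).
have := classic (sat_async c g); tauto.
Qed.

Lemma sat_always a x f c :
  sat_async c (t_always a x f) <->
  forall i, sat_async (iter i (@async_step AP) c) f.
Proof.
split=> /= [h i|h [i [hi _]]]; last exact: hi (h i).
apply: NNPP => hi; apply: h; exists i; split=> // j _; exact: classic.
Qed.

Lemma sat_agree a x s c :
  sat_async c (t_agree a x s) <->
  forall y, y \in s -> (sat_atom c.1 a x <-> sat_atom c.1 a y).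
Proof.
elim: s => [|z s IH]; first by split=> // _; apply/sat_iff.
rewrite [t_agree _ _ _]/= sat_and sat_iff IH; split=> [[hz hs] y|h].
  by rewrite inE => /orP[/eqP->|/hs].
by split=> [|y ys]; apply: h; rewrite inE ?eqxx // ys orbT.
Qed.

Lemma tvars_agree a x s y :
  y \in tvars (t_agree a x s) -> y = x \/ y \in s.
Proof.
elim: s => [|z s IH] /=; rewrite !inE.
  by rewrite !orbb => /eqP; left.
rewrite -/(t_agree a x s) => /or3P[/eqP->|/eqP->|]; [by left|by rewrite eqxx; right|].
case/or3P=> [/eqP->|/eqP->|/IH[->|->]]; rewrite ?eqxx ?orbT; by [left|right].
Qed.

Lemma tsize_agree a x s : tsize (t_agree a x s) = 16 * size s + 12.
Proof. by elim: s => //= y s; rewrite -/(t_agree a x s) => ->; lia. Qed.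

End Connectives.

Lemma tvars_neq_nil (AP : finType) (psi : tform AP) : tvars psi != [::].
Proof. by elim: psi => //= f; case: (tvars f). Qed.

(** * The Kripke structure with a parity bit *)

Section Kripke.

Variables (AP : finType) (K : kripke AP).

Definition parity_label (s : state K * bool) : {set option AP} :=
  [set o | if o is Some a then a \in label s.1 else s.2].

Definition parity_trans : rel (state K * bool) :=
  fun u v => trans u.1 v.1 && (v.2 == ~~ u.2).

Lemma parity_trans_total u : exists v, parity_trans u v.
Proof.
have [s us] := trans_total u.1.
by exists (s, ~~ u.2); rewrite /parity_trans us eqxx.
Qed.

Definition parity_kripke : kripke (option AP) :=
  @Kripke (option AP) (state K * bool)%type [set s | (s.1 \in init K) && ~~ s.2]
    parity_trans parity_label parity_trans_total.

Lemma parity_kripke_size : kripke_size parity_kripke <= 2 * kripke_size K.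
Proof.
rewrite /kripke_size mulnDr /= card_prod card_bool mulnC leq_add2l.
set E := [set e | trans e.1 e.2].
(* The target bit of a transition is the negation of its source bit, so dropping it loses nothing:
   each transition of [K] gives rise to only two. *)
pose f (e : (state K * bool) * (state K * bool)) :=
  ((e.1.1, e.2.1), e.1.2).
set E' := [set e | _].
have f_inj : {in E' &, injective f}.
  move=> [[s b] [s' b']] [[r d] [r' d']]; rewrite !inE /parity_trans /=.
  by move=> /andP[_ /eqP->] /andP[_ /eqP->] [-> -> ->].
have -> : 2 * #|E| = #|setX E [set: bool]|.
  by rewrite cardsX cardsT card_bool mulnC.
rewrite -(card_in_imset f_inj).
apply/subset_leq_card/subsetP => _ /imsetP[e he ->].
by move: he; rewrite !inE /parity_trans /= => /andP[-> _].
Qed.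

End Kripke.

(** * Correspondence of traces and of assignments *)

Section Encoding.

Variable AP : finType.
Implicit Types (sigma : trace AP) (tau : trace (option AP)).
Implicit Types (Pi : assignment AP) (Psi : assignment (option AP))
  (t : trajectory).

Definition encodes sigma tau : Prop :=
  forall i, (forall a, (Some a \in tau i) = (a \in sigma i)) /\
            (None \in tau i) = odd i.

Lemma traces_encode (K : kripke AP) sigma :
  traces K sigma ->
  exists2 tau, traces (parity_kripke K) tau & encodes sigma tau.
Proof.
move=> [rho [rho0 rhoS rhoL]].
pose rho' i : state (parity_kripke K) := (rho i, odd i).
exists (fun i => label (rho' i)); last first.
  by move=> i; split=> [a|]; rewrite inE //= rhoL.
exists rho'; split=> // [|i]; first by rewrite inE rho0.
by rewrite /= /parity_trans rhoS /= eqxx.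
Qed.

(** Initial states carry bit false and each transition flips it, so the bit at position [i] has to
    be [odd i]. *)
Lemma traces_decode (K : kripke AP) tau :
  traces (parity_kripke K) tau ->
  exists2 sigma, traces K sigma & encodes sigma tau.
Proof.
move=> [rho [rho0 rhoS rhoL]].
have rho_odd i : (rho i).2 = odd i.
  elim: i => [|i IH]; first by move: rho0; rewrite inE => /andP[_ /negbTE].
  by have /andP[_ /eqP->] := rhoS i; rewrite IH.
exists (fun i => label (rho i).1); last first.
  by move=> i; split=> [a|]; rewrite rhoL inE.
exists (fun i => (rho i).1); split=> // [|i].
  by move: rho0; rewrite inE => /andP[].
by have /andP[] := rhoS i.
Qed.

(** The invariant of a synchronous run: all pointers, on both sides, stand at the common position
    [n]. *)
Definition encodes_at (n : nat) Pi Psi : Prop :=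
  forall x, match Pi x, Psi x with
  | Some (sigma, p), Some (tau, p') =>
      [/\ encodes sigma tau, p = n & p' = n]
  | None, None => True
  | _, _ => False
  end.

Lemma encodes_at_bind Pi Psi x sigma tau :
  encodes_at 0 Pi Psi -> encodes sigma tau ->
  encodes_at 0 (bind Pi x sigma) (bind Psi x tau).
Proof. by move=> hPi hs y; rewrite /bind; case: eqP => // _; apply: hPi. Qed.

(** Assignments are functions, so [Psi1] is characterised pointwise; this avoids functional
    extensionality. *)
Lemma encodes_at_advance n j Pi Psi Psi1 :
  encodes_at n Pi Psi -> (forall x, Psi1 x = advance xpredT j Psi x) ->
  encodes_at (n + j) (advance xpredT j Pi) Psi1.
Proof.
move=> hPi hPi1 x; rewrite hPi1 /advance /=; have := hPi x.
by case: (Pi x) (Psi x) => [[s p]|] [[s' p']|] //= [? -> ->].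
Qed.

Lemma encodes_at_parity n Pi Psi x :
  encodes_at n Pi Psi -> dom Psi x -> sat_atom Psi None x <-> odd n.
Proof.
rewrite /dom /sat_atom => /(_ x).
by case: (Pi x) (Psi x) => [[s p]|] [[s' p']|] // [hs _ ->] _; rewrite (hs n).2.
Qed.

(** * Trajectories that move every pointer *)

Lemma iter_step_traj (c : assignment (option AP) * trajectory) j i x :
  (iter j (@async_step _) c).2 i x = c.2 (i + j) x.
Proof. by elim: j i => [|j IH] i; rewrite ?addn0 //= IH addSnnS. Qed.

(** Only the moves before [j] are constrained, so that the lemma applies inside the induction of
    [agree_full], where later moves are still unknown. *)
Lemma iter_step_full Psi t j x :
  (forall i y, i < j -> dom Psi y -> t i y) ->
  (iter j (@async_step _) (Psi, t)).1 x = advance xpredT j Psi x.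
Proof.
elim: j => [|j IH] ht /=.
  by rewrite /advance; case: (Psi x) => [[s p]|] //=; rewrite addn0.
have {}IH := IH (fun i y hi => ht i y (ltnW hi)).
rewrite {1}/advance iter_step_traj add0n IH /advance /=.
have := ht j x (ltnSn j); rewrite /dom.
by case: (Psi x) => [[s p]|] /= => [->//|]; [rewrite addn1 addnS|rewrite if_same].
Qed.

Fixpoint t_some (psi : tform AP) : tform (option AP) :=
  match psi with
  | Atom a x => Atom (Some a) x
  | Neg f => Neg (t_some f)
  | Or f g => Or (t_some f) (t_some g)
  | Until f g => Until (t_some f) (t_some g)
  | Next f => Next (t_some f)
  end.

Lemma tvars_some psi : tvars (t_some psi) = tvars psi.
Proof. by elim: psi => //= f -> g ->. Qed.

Lemma tsize_some psi : tsize (t_some psi) = tsize psi.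
Proof. by elim: psi => //= [f ->|f -> g ->|f -> g ->|f ->]. Qed.

(** When every bound pointer moves at every step, one asynchronous step is one synchronous step. The
    hypotheses survive passing to a suffix, with a larger [n], which carries the induction through
    [Until] and [Next]. *)
Lemma sat_some psi n Pi (c : assignment (option AP) * trajectory) :
  encodes_at n Pi c.1 -> (forall j x, dom c.1 x -> c.2 j x) ->
  sat_async c (t_some psi) <-> sat_sync Pi psi.
Proof.
elim: psi n Pi c => [a x|f IHf|f IHf g IHg|f IHf g IHg|f IHf] n Pi c hPi ht.
- rewrite /= /sat_atom; have := hPi x.
  by case: (Pi x) (c.1 x) => [[s p]|] [[s' p']|] // [hs -> ->]; rewrite (hs n).1.
- by rewrite /= (IHf n Pi c).
- by rewrite /= (IHf n Pi c) // (IHg n Pi c).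
- have iterE j x :
      (iter j (@async_step _) c).1 x = advance xpredT j c.1 x.
    by case: c ht {hPi} => Psi t ht; apply: iter_step_full => i y _; apply: ht.
  have enc j := encodes_at_advance hPi (iterE j).
  have full j i x : dom (iter j (@async_step _) c).1 x ->
      (iter j (@async_step _) c).2 i x.
    rewrite iter_step_traj /dom iterE /advance /= => hx; apply: ht.
    by move: hx; rewrite /dom; case: (c.1 x).
  split=> /= -[j [hj hi]]; exists j; split.
  + exact/(IHg _ _ _ (enc j) (full j)).
  + by move=> i /hi /(IHf _ _ _ (enc i) (full i)).
  + exact/(IHg _ _ _ (enc j) (full j)).
  + by move=> i /hi /(IHf _ _ _ (enc i) (full i)).
- have stepE x : (async_step c).1 x = advance xpredT 1 c.1 x.
    by case: c ht {hPi} => Psi t ht; apply: (@iter_step_full _ _ 1) => i y _; apply: ht.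
  apply: (IHf (n + 1)); first exact: encodes_at_advance hPi stepE.
  move=> j x; rewrite /dom stepE /advance /= => hx; apply: ht.
  by move: hx; rewrite /dom; case: (c.1 x).
Qed.

(** Strong induction on [j]: if all earlier moves were full, every pointer is at [n + j], and a
    pointer left behind at step [j] would differ in parity from one that moves. *)
Lemma agree_full n Pi Psi t x0 vs :
  encodes_at n Pi Psi -> trajectory_over (dom Psi) t ->
  (forall x, dom Psi x -> x \in vs) ->
  (forall i, sat_async (iter i (@async_step _) (Psi, t)) (t_agree None x0 vs)) ->
  forall j x, dom Psi x -> t j x.
Proof.
move=> hPi ht hvs hagree j; elim/ltn_ind: j => j IH x hx.
have iterE y : (iter j (@async_step _) (Psi, t)).1 y = advance xpredT j Psi y.
  by apply: iter_step_full => i z hi; apply: IH.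
have enc := encodes_at_advance hPi iterE.
(* Some [y] moves at step [j], as trajectory sets are nonempty; agreement just after that step
   compares [x] with [y] through [x0]. *)
have [[y tjy] /(_ y tjy) hy] := ht j.
have /sat_agree hj := hagree j.+1.
have {hj} := iff_trans (iff_sym (hj x (hvs x hx))) (hj y (hvs y hy)).
(* The boolean [t j z] is read as 0 or 1, the amount by which step [j] moves [z]. *)
have parity z : dom Psi z ->
    sat_atom (iter j.+1 (@async_step _) (Psi, t)).1 None z
    <-> odd (n + j + t j z).
  move=> hz; rewrite /= /sat_atom {1}/advance iter_step_traj add0n iterE.
  have := hPi z; move: hz; rewrite /dom /advance /=.
  case: (Pi z) (Psi z) => [[s p]|] [[s' p']|] //= _ [hs _ ->].
  by case: ifP => _ /=; rewrite (hs _).2 ?addn0.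
rewrite !parity // tjy; case: (t j x) => //.
by rewrite addn0 addn1 /=; case: (odd _) => -[]; [move/(_ isT)|move=> _ /(_ isT)].
Qed.

Lemma full_agree n Pi Psi t x0 vs :
  encodes_at n Pi Psi -> (forall j x, dom Psi x -> t j x) ->
  dom Psi x0 -> (forall x, x \in vs -> dom Psi x) ->
  forall i, sat_async (iter i (@async_step _) (Psi, t)) (t_agree None x0 vs).
Proof.
move=> hPi ht hx0 hvs i; apply/sat_agree => y /hvs hy.
have iterE z : (iter i (@async_step _) (Psi, t)).1 z = advance xpredT i Psi z.
  by apply: iter_step_full => k w _; apply: ht.
have enc := encodes_at_advance hPi iterE.
have domE z : dom Psi z -> dom (iter i (@async_step _) (Psi, t)).1 z.
  by rewrite /dom iterE /advance /=; case: (Psi z).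
by rewrite !(encodes_at_parity enc) //; apply: domE.
Qed.

(** * The translated formula: correctness, closedness and size *)

Fixpoint qvars (phi : hyperltl AP) : seq tvar :=
  match phi with
  | HExists x phi1 | HForall x phi1 => x :: qvars phi1
  | HTemp _ => [::]
  end.

Fixpoint synchronize (x0 : tvar) (vs : seq tvar) (phi : hyperltl AP) :
    ahltl (option AP) :=
  match phi with
  | HExists x phi1 => AExists x (synchronize x0 vs phi1)
  | HForall x phi1 => AForall x (synchronize x0 vs phi1)
  | HTemp psi =>
      AE (t_and (t_always None x0 (t_agree None x0 vs)) (t_some psi))
  end.

(** The list [vs] stays fixed while quantifiers are peeled off: each variable in it is either bound
    already or still to be quantified. At the temporal part it is therefore exactly the domain. *)
Lemma synchronize_sat (K : kripke AP) x0 vs phi Pi Psi :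
  x0 \in vs -> encodes_at 0 Pi Psi ->
  (forall x, (x \in vs) = dom Psi x || (x \in qvars phi)) ->
  hsat (traces K) Pi phi <->
  asat (traces (parity_kripke K)) Psi (synchronize x0 vs phi).
Proof.
move=> hx0; elim: phi Pi Psi => [x phi IH|x phi IH|psi] Pi Psi hPi hvs.
- have bindE s y : (y \in vs) = dom (bind Psi x s) y || (y \in qvars phi).
    by rewrite hvs /= inE /dom /bind; case: (y == x); rewrite ?orbT.
  split=> -[s [Ts hs]].
    have [s' Ts' ss'] := traces_encode Ts; exists s'; split=> //.
    exact/(IH _ _ (encodes_at_bind x hPi ss') (bindE s')).
  have [s' Ts' ss'] := traces_decode Ts; exists s'; split=> //.
  exact/(IH _ _ (encodes_at_bind x hPi ss') (bindE s)).
- have bindE s y : (y \in vs) = dom (bind Psi x s) y || (y \in qvars phi).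
    by rewrite hvs /= inE /dom /bind; case: (y == x); rewrite ?orbT.
  split=> h s Ts.
    have [s' Ts' ss'] := traces_decode Ts.
    exact/(IH _ _ (encodes_at_bind x hPi ss') (bindE s))/h.
  have [s' Ts' ss'] := traces_encode Ts.
  exact/(IH _ _ (encodes_at_bind x hPi ss') (bindE s'))/h.
- have {}hvs x : (x \in vs) = dom Psi x by rewrite hvs orbF.
  split=> [h|[t [ht _]]].
    (* The trajectory moves precisely the bound variables at each step; [x0] witnesses
       nonemptiness. *)
    exists (fun=> dom Psi); split=> [j|x hx n|].
    + by split=> //; exists x0; rewrite -hvs.
    + by exists n.
    apply/sat_and; split; last by apply/(sat_some psi (c := (_, _)) hPi).
    apply/sat_always; apply: full_agree hPi _ _ _ => // [|x]; by rewrite -hvs.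
  move=> /sat_and[/sat_always hagree hpsi].
  apply/(sat_some psi (c := (Psi, t)) hPi) => //=.
  by apply: agree_full hPi ht _ hagree => x; rewrite hvs.
Qed.

(** The agreement formula mentions all of [vs], so below some quantifiers the outer variables occur
    free. Once [vs] is [qvars phi], the second alternative is void. *)
Lemma afree_synchronize x0 vs phi y :
  x0 \in vs -> y \in afree (synchronize x0 vs phi) ->
  y \in hfree phi \/ (y \in vs /\ y \notin qvars phi).
Proof.
move=> hx0; elim: phi => [x phi IH|x phi IH|psi] /=.
- by rewrite !mem_filter inE => /andP[/negbTE-> /IH].
- by rewrite !mem_filter inE => /andP[/negbTE-> /IH].
rewrite !(inE, mem_cat) tvars_some.
case/or4P=> [/eqP->|/eqP->|/tvars_agree[->|->]|->]; by [right|left].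
Qed.

Lemma asize_synchronize x0 vs phi :
  asize (synchronize x0 vs phi) = hsize phi + 16 * size vs + 24.
Proof.
elim: phi => [x phi /= ->|x phi /= ->|psi] //=.
by rewrite tsize_agree tsize_some; lia.
Qed.

Lemma size_qvars phi : size (qvars phi) <= hsize phi.
Proof. by elim: phi. Qed.

(** Every temporal formula contains an atom, so a closed formula must begin with a quantifier; its
    variable serves as the reference [x0]. *)
Lemma qvars_neq_nil phi : hclosed phi -> qvars phi != [::].
Proof. by case: phi => // psi /eqP; rewrite (negbTE (tvars_neq_nil psi)). Qed.

End Encoding.

Theorem theorem6 :
  exists (c : nat) (p : {poly nat}),
  forall AP : finType,
  exists (AP' : finType)
    (tr_form : hyperltl AP -> ahltl AP') (tr_kripke : kripke AP -> kripke AP'),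
  forall (phi : hyperltl AP) (K : kripke AP), hclosed phi ->
    let phi' := tr_form phi in
    let K' := tr_kripke K in
    [/\ aclosed phi',
        (kripke_size K' <= c * kripke_size K)%N,
        (asize phi' <= (p.[hsize phi])%R)%N
      & hmodels K phi <-> amodels K' phi'].
Proof.
(* The bound is 17 n + 24, constant coefficient first: the size is
   [hsize phi + 16 * size (qvars phi) + 24], and [size (qvars phi)] is at most [hsize phi]. *)
exists 2, (Poly [:: 24; 17]) => AP; exists (option AP).
exists (fun phi => synchronize (head 0 (qvars phi)) (qvars phi) phi).
exists (@parity_kripke AP) => phi K closed_phi phi' K'.
have hx0 : head 0 (qvars phi) \in qvars phi.
  by case: (qvars phi) (qvars_neq_nil closed_phi) => //= x s _; rewrite mem_head.
split; first 1 last.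
- exact: parity_kripke_size.
- rewrite /phi' asize_synchronize horner_Poly /=.
  have -> : ((0 * hsize phi + 17) * hsize phi + 24)%R = 17 * hsize phi + 24.
    by rewrite GRing.mul0r GRing.add0r.
  by have := size_qvars phi; lia.
- by apply: synchronize_sat.
rewrite /aclosed; case E: (afree phi') => [//|y s].
have : y \in afree phi' by rewrite E mem_head.
by case/(afree_synchronize hx0) => [|[->//]]; rewrite closed_phi.
Qed.
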